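(* Assume $\mathfrak p=\mathfrak b$. Then there is a countable Hausdorff 0-dimensional Fréchet-Urysohn space that is not H-separable and has $\pi$-weight $\mathfrak b$.
   Context: A space is 0-dimensional if it has a base consisting of clopen sets. A space $X$ is Fréchet-Urysohn if for every $A\subset X$ and $x\in\overline{A}\setminus A$ there is a sequence $S\subset A$ converging to $x$. A space $X$ is H-separable if for every sequence $\{D_n : n\in\omega\}$ of dense subsets of $X$ there is a selection of finite sets $F_n\subset D_n$ ($n\in\omega$) such that for every infinite $A\subset\omega$ the set $\bigcup\{F_n : n\in A\}$ is dense in $X$. The $\pi$-weight of $X$ is the least cardinality of a $\pi$-base, i.e. of a family of nonempty open sets such that every nonempty open set contains a member of the family. $\mathfrak b$ is the least cardinality of a subset of $\omega^\omega$ that is unbounded with respect to the mod finite order $<^*$. $\mathfrak p$ is the pseudointersection number: the least cardinality of a family of infinite subsets of $\omega$ all of whose finite subfamilies have infinite intersection but which has no infinite pseudointersection (no infinite set almost contained in every member). *)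

(* Defs.v *)
From mathcomp Require Import all_boot all_order all_algebra.
From mathcomp Require Import all_classical all_analysis.

Set Implicit Arguments.
Unset Strict Implicit.
Unset Printing Implicit Defensive.

Local Open Scope classical_set_scope.
Local Open Scope card_scope.

(* The cardinal being defined is represented by any set [K] having that
   cardinality. *)
Definition least_cardinality (T : Type) (P : set (set T))
    (U : Type) (K : set U) : Prop :=
  (exists2 F : set T, P F & F #= K) /\ (forall F : set T, P F -> K #<= F).

Definition lt_mod_finite (f g : nat -> nat) : Prop :=
  \forall n \near \oo, (f n < g n)%N.

Definition unbounded_family (F : set (nat -> nat)) : Prop :=
  ~ exists g : nat -> nat, forall f, F f -> lt_mod_finite f g.

Definition is_bounding_number (U : Type) (K : set U) : Prop :=
  least_cardinality unbounded_family K.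

Definition almost_subset (A B : set nat) : Prop := finite_set (A `\` B).

(* The empty subfamily is harmless: its intersection is [setT]. *)
Definition strong_fip (F : set (set nat)) : Prop :=
  forall G : set (set nat), G `<=` F -> finite_set G ->
    infinite_set (\bigcap_(A in G) A).

Definition has_infinite_pseudointersection (F : set (set nat)) : Prop :=
  exists2 P : set nat, infinite_set P & forall A, F A -> almost_subset P A.

Definition is_pseudointersection_number (U : Type) (K : set U) : Prop :=
  least_cardinality
    [set F : set (set nat) | [/\ forall A, F A -> infinite_set A,
       strong_fip F & ~ has_infinite_pseudointersection F]] K.

(* [zero_dimensional] of the library only separates points by clopen sets. *)
Definition has_clopen_base (X : topologicalType) : Prop :=
  exists2 B : set (set X), B `<=` clopen & basis B.

Definition frechet_urysohn (X : topologicalType) : Prop :=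
  forall (A : set X) (x : X), (closure A `\` A) x ->
    exists2 s : nat -> X, forall n, A (s n) & s @ \oo --> x.

Definition h_separable (X : topologicalType) : Prop :=
  forall D : nat -> set X, (forall n, dense (D n)) ->
    exists2 F : nat -> set X,
      forall n, finite_set (F n) /\ F n `<=` D n &
      forall A : set nat, infinite_set A -> dense (\bigcup_(n in A) F n).

Definition pi_base (X : topologicalType) (B : set (set X)) : Prop :=
  (forall V, B V -> open V /\ V !=set0) /\
  (forall O : set X, open O -> O !=set0 -> exists2 V, B V & V `<=` O).

Definition is_pi_weight (X : topologicalType) (U : Type) (K : set U) : Prop :=
  least_cardinality (@pi_base X) K.

(* Main.v *)
Require Import Defs.
From mathcomp Require Import all_boot all_order all_algebra.
From mathcomp Require Import all_classical all_analysis.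
From HB Require Import structures.
From mathcomp Require Import zify.
From mathcomp Require wochoice.

Local Open Scope classical_set_scope.
Local Open Scope card_scope.

(** Call an index set small if every family of functions indexed by it is
    bounded for the order mod finite; by the hypothesis on the bounding number
    this means that it does not have at least [kappa] elements ([smallP]), and
    by the hypothesis on the pseudointersection number every small family of
    sets of integers with infinite finite intersections has an infinite
    pseudointersection ([small_pseudointersection]).

    Let [f a], [a] in [I], be an unbounded family indexed by a well-order whose
    initial segments are small.  A transfinite recursion gives a tower: infinite
    sets [x a], decreasing mod finite, whose gaps are longer than [f a]
    prescribes.  Hence for every [g] some [x a] has infinitely many elements [n]
    without any element in [(n, g n]] ([tower_unbounded]).

    The points of the space are the finite sequences of entries, an entry being
    determined by its column [n] and its height [h > n]; the heights increase
    along the sequence.  An entry hits a set [x] if [n] is in [x] and no element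
    of [x] lies strictly between [n] and [h].  Put [value x t = true] if the last
    entry of [t] hits [x], or if some earlier entry does so and [x] has an
    element between its height and the next height.  The topology is generated
    by declaring clopen the sets of all extensions of a given sequence and the
    sets of all [t] with [value (x a) t = true].

    - Appending to [t] an entry of column [n] and of large height changes no
      given coordinate of [t], so the set [D_n] of the sequences with last
      column [n] is dense. If [n] is in [x a] and [x a] has no element in [(n,
      g n]], then every point of [D_n] of height at most [g n] has value
      [true] at [x a], and the empty sequence has value [false]. So no choice
      of finite parts of the [D_n] witnesses H-separability, and no small
      family of open sets is a pi-base ([column_set_avoid]).

    - Let [c] extend [t]. If [x] has an element between the height of [t] and
      the first new height, but none between the latter and the last height,
      then all new entries but the last one are forgotten, and [value x c =
      value x t] unless the last entry of [c] hits [x] ([value_branch]). Let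
      [t] be in the closure of [A]. For each [a], small pseudointersections
      give a sequence in [A] converging to [t] in all coordinates below [a].
      By unboundedness some later [x b] misses, along a subsequence, the
      intervals spanned by the new heights, and then so does every later
      member of the tower, up to finitely many terms. Doing this along an
      increasing sequence of indices with supremum [al] and diagonalizing,
      which is possible since the segment below [al] is small, gives a
      sequence converging in all coordinates ([converges_exists]).

    - The cylinders form a base.  Those with coordinates below a fixed [a]
      form a small family, and a union of small sets along [I] has at most
      [kappa] elements ([small_fibers_card_le]). *)

(** * Sets of integers and the order mod finite *)

Lemma lt_mod_finiteP {f g : nat -> nat} :
  lt_mod_finite f g <-> exists N, forall n, (N <= n)%N -> (f n < g n)%N.
Proof.
split=> [[N _ H]|[N H]]; first by exists N => n /H.
by exists N => // n /= /H.
Qed.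

Lemma infinite_natP (A : set nat) :
  infinite_set A <-> forall k, exists2 n, (k <= n)%N & A n.
Proof.
split=> [Ainf k|H /finite_seqP[s As]].
  apply: contrapT => H; apply: Ainf; apply: (@sub_finite_set _ _ `I_k).
    move=> n An /=; rewrite ltnNge; apply/negP => kn; apply: H.
    by exists n.
  exact: finite_II.
have [n sn An] := H (\max_(i <- s) i).+1.
move: An; rewrite As /= => ns.
by have := @leq_bigmax_seq _ s xpredT id n ns erefl; lia.
Qed.

Lemma finite_natP (A : set nat) :
  finite_set A <-> exists k, forall n, A n -> (n < k)%N.
Proof.
split=> [Afin|[k H]]; last exact: (sub_finite_set H (finite_II k)).
apply: contrapT => H; have : infinite_set A; last by apply.
apply/infinite_natP => k; apply: contrapT => Hk; apply: H; exists k => n An.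
by rewrite ltnNge; apply/negP => kn; apply: Hk; exists n.
Qed.

Lemma almost_subsetP (A B : set nat) :
  almost_subset A B <-> exists k, forall n, (k <= n)%N -> A n -> B n.
Proof.
rewrite /almost_subset finite_natP; split=> -[k H]; exists k => n.
  move=> kn An; apply: contrapT => nB.
  by have := H n (conj An nB); rewrite ltnNge kn.
by case=> An nB; rewrite ltnNge; apply/negP => /H/(_ An).
Qed.

(** * Small index sets *)

(** [A] is small if every family of functions indexed by [A] is bounded mod
    finite.  This is a statement on the cardinality of [A] alone, see [smallP]
    below; this form makes closure under small unions immediate. *)
Definition small {J : Type} (A : set J) : Prop :=
  forall e : J -> nat -> nat, exists g, forall j, A j -> lt_mod_finite (e j) g.

Lemma small_sub {J : Type} (A B : set J) : A `<=` B -> small B -> small A.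
Proof. by move=> AB sB e; have [g Hg] := sB e; exists g => j /AB/Hg. Qed.

Lemma small_image {J J' : Type} (f : J -> J') (A : set J) :
  small A -> small (f @` A).
Proof.
move=> sA e; have [g Hg] := sA (e \o f); exists g => _ [j Aj <-].
exact: Hg.
Qed.

Lemma small_nat (A : set nat) : small A.
Proof.
move=> e; exists (fun n => (\max_(i < n.+1) e i n).+1) => j _.
apply/lt_mod_finiteP; exists j => n jn.
have jn' : (j < n.+1)%N by [].
exact: (@leq_bigmax _ (fun i : 'I_n.+1 => e i n) (Ordinal jn')).
Qed.

Lemma small_countType (T : countType) (A : set T) : small A.
Proof.
move=> e.
have [g Hg] := small_nat setT
  (fun n => if unpickle n is Some t then e t else fun=> 0).
by exists g => t _; have := Hg (pickle t) I; rewrite pickleK.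
Qed.

Lemma small_bigcup {J J' : Type} (A : set J) (B : J -> set J') :
  small A -> (forall a, A a -> small (B a)) -> small (\bigcup_(a in A) B a).
Proof.
move=> sA sB e.
have /choice[g Hg] : forall a, exists g, A a ->
    forall j, B a j -> lt_mod_finite (e j) g.
  move=> a; have [Aa|nA] := pselect (A a); last by exists (fun=> 0).
  by have [g Hg] := sB a Aa e; exists g.
have [h Hh] := sA g; exists h => j [a Aa Baj].
have /lt_mod_finiteP[N HN] := Hg a Aa j Baj.
have /lt_mod_finiteP[M HM] := Hh a Aa.
apply/lt_mod_finiteP; exists (N + M) => n n1.
by apply: (ltn_trans (HN n _) (HM n _)); lia.
Qed.

Lemma small_setU {J : Type} (A B : set J) :
  small A -> small B -> small (A `|` B).
Proof.
move=> sA sB; rewrite -bigcup2E; apply: small_bigcup; first exact: small_nat.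
by move=> [|[|n]] _ //=; apply: (small_sub _ A) => // ? [].
Qed.

Lemma small_set1 {J : Type} (j : J) : small [set j].
Proof.
move=> e; exists (fun n => (e j n).+1) => _ ->.
by apply/lt_mod_finiteP; exists 0.
Qed.

Lemma small_seq {J : Type} (A : set J) :
  small A -> small [set s : seq J | forall j, List.In j s -> A j].
Proof.
move=> sA.
pose B n := [set s : seq J | size s = n /\ forall j, List.In j s -> A j].
apply: (@small_sub _ _ (\bigcup_(n in setT) B n)).
  by move=> s Hs; exists (size s).
apply: small_bigcup; first exact: small_nat.
move=> n _; elim: n => [|n IH].
  by apply: (small_sub _ _ _ (small_set1 [::])) => -[|a s] [].
apply: (@small_sub _ _ (\bigcup_(a in A) [set a :: s | s in B n])).
  case=> [[//]|a s [/= [ss] H]]; exists a; first by apply: H; left.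
  by exists s => //; split=> // j js; apply: H; right.
by apply: small_bigcup => // a _; apply: small_image.
Qed.

Section bounding.
Context {U : Type} (kappa : set U).
Hypothesis hb : is_bounding_number kappa.

Lemma smallP {J : Type} (A : set J) : small A <-> ~ (kappa #<= A).
Proof.
have [[F Funb FK] Kle] := hb.
split=> [sA KA|nKA e].
  have : F #<= A by rewrite (card_le_eql FK).
  move=> /card_subP[C CF CA].
  move: CF => /card_set_bijP[e [_ _ esurj]].
  apply: Funb; have [g Hg] := sA e; exists g => f /esurj[j Cj <-].
  by apply: Hg; apply: CA.
apply: contrapT => H; apply: nKA.
apply: (@card_le_trans _ _ _ (e @` A)); last exact: card_image_le.
apply: Kle => -[g Hg]; apply: H; exists g => j Aj; apply: Hg.
by exists j.
Qed.

Lemma not_small_kappa {J : Type} (A : set J) : ~ small A <-> (kappa #<= A).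
Proof. by rewrite smallP notK. Qed.

Lemma small_card_le {J J' : Type} (A : set J) (B : set J') :
  A #<= B -> small B -> small A.
Proof.
move=> AB /smallP nKB; apply/smallP => KA; apply: nKB.
exact: card_le_trans AB.
Qed.

End bounding.

(** * Well-orders with small initial segments *)

(** Definition by well-founded recursion of a function whose value at each
    point is chosen subject to a condition on the values at smaller points. *)
Lemma wf_rec_choice {I V : Type} (lt : I -> I -> Prop) (v0 : V)
    (P : I -> (I -> V) -> V -> Prop) :
  well_founded lt ->
  (forall a g g' v, (forall b, lt b a -> g b = g' b) -> P a g v -> P a g' v) ->
  (forall a g, (forall b, lt b a -> P b g (g b)) -> exists v, P a g v) ->
  exists g, forall a, P a g (g a).
Proof.
move=> wf Pext Pex.
pose ext a (rec : forall b, lt b a -> V) b :=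
  if pselect (lt b a) is left p then rec b p else v0.
pose body a rec := if pselect (exists v, P a (ext a rec) v) is left p
  then projT1 (cid p) else v0.
pose g := Fix wf (fun=> V) body.
have gE a : g a = body a (fun b _ => g b).
  apply: (Fix_eq wf (fun=> V)) => x r1 r2 H.
  suff -> : r1 = r2 by [].
  by apply: functional_extensionality_dep => b;
    apply: functional_extensionality_dep => p.
exists g => a; elim/(well_founded_ind wf): a => a IH.
have extg b : lt b a -> ext a (fun b _ => g b) b = g b.
  by rewrite /ext; case: pselect.
rewrite gE /body; case: pselect => [p|np].
  by case: cid => v /= Pv; apply: Pext Pv.
exfalso; apply: np; have [v Pv] := Pex a g IH; exists v.
by apply: Pext Pv => b /extg.
Qed.

(** The order [lt] is a strict well-order all of whose initial segments are
    small, as is the initial ordinal of the bounding number. *)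
Record scale_order (I : Type) (lt : I -> I -> Prop) : Prop := ScaleOrder {
  so_wf : well_founded lt;
  so_trans : forall a b c, lt a b -> lt b c -> lt a c;
  so_total : forall a b, [\/ lt a b, a = b | lt b a];
  so_small : forall a, small [set b | lt b a]
}.

Lemma wf_min {T : Type} (lt : T -> T -> Prop) (A : set T) :
  well_founded lt -> A !=set0 -> exists2 a, A a & forall b, lt b a -> ~ A b.
Proof.
move=> wf [x Ax]; apply: contrapT => H.
elim/(well_founded_ind wf): x Ax => a IH Aa.
by apply: H; exists a => // b ba /(IH b ba).
Qed.

Lemma well_order_exists (T : Type) : exists lt : T -> T -> Prop,
  [/\ well_founded lt, forall a b c, lt a b -> lt b c -> lt a c &
      forall a b, [\/ lt a b, a = b | lt b a]].
Proof.
have [R wo] := wochoice.well_ordering_principle {classic T}.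
have mint (A : set T) : A !=set0 ->
    exists2 z, A z & forall y, A y -> R z y.
  move=> [x Ax]; have [|z [[zA lz] _]] := wo (mem A).
    by exists x; apply/mem_set.
  by exists z; [exact: set_mem|move=> y Ay; apply: lz; apply/mem_set].
have anti a b : R a b -> R b a -> a = b.
  move=> ab ba; have [|z [_ zu]] := wo (mem [set a; b]).
    by exists a; apply/mem_set; left.
  have Rr c : R c c.
    have [|z' Ez' /(_ _ erefl)] := mint [set c]; first by exists c.
    by rewrite Ez'.
  rewrite -(zu a); last first.
    split; first by apply/mem_set; left.
    by move=> c /set_mem [->|->].
  apply: zu; split; first by apply/mem_set; right.
  by move=> c /set_mem [->|->].
have tot a b : R a b \/ R b a.
  have [|z [->|->] H] := mint [set a; b]; first by exists a; left.
    by left; apply: H; right.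
  by right; apply: H; left.
have tr a b c : R a b -> R b c -> R a c.
  move=> ab bc; have [|z [[->|->]|->] H] := mint ([set a; b] `|` [set c]).
  - by exists a; left; left.
  - by apply: H; right.
  - rewrite (anti a b ab) //; apply: H; left; left=> //.
  - have cb : c = b by apply: anti => //; apply: H; left; right.
    by rewrite cb.
exists (fun a b => R a b /\ a <> b); split.
- move=> x; apply: contrapT => nx.
  have [|z nz zl] := mint [set x | ~ Acc (fun a b => R a b /\ a <> b) x].
    by exists x.
  apply: nz; constructor=> y [yz nyz]; apply: contrapT => ny.
  by apply: nyz; apply: anti => //; apply: zl.
- move=> a b c [ab nab] [bc nbc]; split; first exact: tr bc.
  by move=> ac; apply: nab; apply: anti => //; rewrite ac.
- move=> a b; have [->|nab] := pselect (a = b); first exact: Or32.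
  have [ab|ba] := tot a b; first exact: Or31.
  by apply: Or33; split=> // /esym.
Qed.

Lemma sval_injective {T : Type} (S : T -> Prop) :
  injective (fun x : {t | S t} => sval x).
Proof. by move=> [a Sa] [b Sb] /= ab; apply: eq_exist. Qed.

(** Well-order an unbounded family of size [kappa] and cut it at the first
    element with a segment that is not small, if there is one.  The part below
    still has [kappa] elements, so it indexes the whole family. *)
Lemma scale_exists {U : Type} (kappa : set U) : is_bounding_number kappa ->
  exists (I : Type) (lt : I -> I -> Prop) (f : I -> nat -> nat),
    scale_order I lt /\ unbounded_family (range f).
Proof.
move=> hb; have [[F Funb FK] Kle] := hb.
have [lt [wf tr tot]] := well_order_exists (nat -> nat).
(* the part of [F] below the cut *)
pose S := [set b | F b /\ forall c, F c -> (lt c b \/ c = b) ->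
                     small [set d | F d /\ lt d c]].
have FS : F #<= S.
  have [allS|] := pselect (F `<=` S); first exact: subset_card_le.
  move=> nS.
  have [|b [Fb nb] bmin] := @wf_min _ lt
    [set c | F c /\ ~ small [set d | F d /\ lt d c]] wf.
    apply: contrapT => H; apply: nS => b Fb; split=> // c Fc _.
    by apply: contrapT => nc; apply: H; exists c.
  apply: (@card_le_trans _ _ _ [set d | F d /\ lt d b]).
    by rewrite (card_le_eql FK); apply/(not_small_kappa _ hb).
  apply: subset_card_le => d [Fd db]; split=> // c Fc cd.
  apply: contrapT => nc; apply: (bmin c) => //.
  by case: cd => [cd|->//]; apply: tr db.
move: FS => /card_subP[C CF CS].
move: CF => /card_set_bijP[e [_ _ esurj]].
exists {s | S s}, (fun a b => lt (sval a) (sval b)),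
  (fun a => e (sval a)); split.
- split.
  + move=> [x Sx]; elim/(well_founded_ind wf): x Sx => x IH Sx.
    by constructor=> -[y Sy] /= yx; apply: IH.
  + by move=> a b c; apply: tr.
  + move=> [a Sa] [b Sb] /=; have [ab|ab|ab] := tot a b.
    * exact: Or31.
    * by apply: Or32; apply: eq_exist.
    * exact: Or33.
  + move=> [a Sa] /=; have /= sm := Sa.2 a Sa.1 (or_intror erefl).
    apply: (small_card_le _ hb _ _ _ sm).
    rewrite -(card_le_eql (inj_card_eq (in2W (@sval_injective _ S)))).
    apply: subset_card_le => _ [[b Sb] /= ba <-].
    by split=> //; have [] := Sb.
- move=> [g Hg]; apply: Funb; exists g => f /esurj[b Cb <-].
  by apply: Hg; exists (exist _ b (CS b Cb)).
Qed.

Section scale_theory.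
Context {U : Type} (kappa : set U).
Hypothesis hb : is_bounding_number kappa.
Context {I : Type} {lt : I -> I -> Prop} {f : I -> nat -> nat}.
Hypothesis so : scale_order I lt.
Hypothesis funb : unbounded_family (range f).

(** Otherwise the index set is a countable union of small sets, so it is small
    and [f] is bounded. *)
Lemma omega_bounded (alpha : nat -> I) : exists a, forall n, lt (alpha n) a.
Proof.
apply: contrapT => H; apply: funb.
suff sI : small [set: I].
  by have [g Hg] := sI f; exists g => _ [a _ <-]; apply: Hg.
apply: (@small_sub _ _
  (\bigcup_(n in setT) ([set b | lt b (alpha n)] `|` [set alpha n]))).
  move=> a _; have [n nlt] : exists n, ~ lt (alpha n) a.
    by apply: contrapT => Hn; apply: H; exists a => n;
      apply: contrapT => nlt; apply: Hn; exists n.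
  exists n => //; have [//|->|] := so_total _ _ so (alpha n) a; first by right.
  by left.
apply: small_bigcup => [|n _]; first exact: small_nat.
by apply: small_setU; [exact: (so_small _ _ so)|exact: small_set1].
Qed.

Lemma omega_lub (alpha : nat -> I) : exists2 a, forall n, lt (alpha n) a &
  forall b, lt b a -> exists n, b = alpha n \/ lt b (alpha n).
Proof.
have [a Ha amin] := wf_min lt _ (so_wf _ _ so) (omega_bounded alpha).
exists a => // b /amin Hb; apply: contrapT => Hn; apply: Hb => n.
have [//|ab|ba] := so_total _ _ so (alpha n) b.
  by exfalso; apply: Hn; exists n; left.
by exfalso; apply: Hn; exists n; right.
Qed.

Lemma seq_bounded (s : seq I) : exists a, forall b, List.In b s -> lt b a.
Proof.
elim: s => [|c s [a Ha]].
  apply: contrapT => H; apply: funb; exists id => _ [a _ <-].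
  by exfalso; apply: H; exists a.
have [d Hd] := omega_bounded (fun n => if n is 0 then a else c).
exists d => b [<-|bs]; first exact: (Hd 1).
by apply: (so_trans _ _ so) (Ha b bs) (Hd 0).
Qed.

(** A union of small sets along [I] has at most [kappa] elements: ordering it
    first by [r], then by any well-order, makes all its initial segments small,
    and an injection into a family of size [kappa] is built by recursion. *)
Lemma small_fibers_card_le {T : Type} (r : T -> I) :
  (forall a, small [set y | r y = a \/ lt (r y) a]) -> [set: T] #<= kappa.
Proof.
move=> sr; have [ltT [wfT _ totT]] := well_order_exists T.
pose lex y y' := lt (r y) (r y') \/ r y = r y' /\ ltT y y'.
have lex_wf : well_founded lex.
  move=> y; have [a ra] : exists a, r y = a by exists (r y).
  elim/(well_founded_ind (so_wf _ _ so)): a y ra => a IHa y.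
  elim/(well_founded_ind wfT): y => y IHy ra.
  constructor=> z [zy|[zy zTy]]; first by apply: (IHa (r z)) => //; rewrite -ra.
  by apply: IHy => //; rewrite zy.
have [[F Funb FK] _] := hb.
have [||g Hg] := @wf_rec_choice T (nat -> nat) lex id
  (fun y g v => F v /\ forall z, lex z y -> g z <> v) lex_wf.
- by move=> y g g' v gg' [Fv Hv]; split=> // z zy; rewrite -gg' //; apply: Hv.
- move=> y g _; apply: contrapT => H.
  have sF : small F.
    apply: (@small_sub _ _ (g @` [set z | lex z y])).
      move=> v Fv; apply: contrapT => Hv; apply: H; exists v; split=> // z zy.
      by move=> gz; apply: Hv; exists z.
    apply: small_image; apply: (small_sub _ _ _ (sr (r y))).
    by move=> z [zy|[zy _]]; [right|left].
  apply: Funb; have [h Hh] := sF id.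
  by exists h.
have ginj : injective g.
  move=> y z gyz; have [yz|yz|zy] := so_total _ _ so (r y) (r z).
  - by have [_ /(_ y (or_introl yz))] := Hg z.
  - have [yTz|//|zTy] := totT y z.
    + by have [_ /(_ y (or_intror (conj yz yTz)))] := Hg z.
    + by have [_ /(_ z (or_intror (conj (esym yz) zTy)))] := Hg y; rewrite gyz.
  - by have [_ /(_ z (or_introl zy))] := Hg y; rewrite gyz.
rewrite -(card_le_eqr FK) -(card_le_eql (inj_card_eq (in2W ginj))).
by apply: subset_card_le => _ [y _ <-]; have [] := Hg y.
Qed.

(** * The tower *)

Hypothesis hp : is_pseudointersection_number kappa.

Lemma small_pseudointersection {J : Type} (A : set J) (E : J -> set nat) :
  small A ->
  (forall s, (forall j, List.In j s -> A j) ->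
     infinite_set [set n | forall j, List.In j s -> E j n]) ->
  exists2 P : set nat, infinite_set P & forall j, A j -> almost_subset P (E j).
Proof.
move=> sA fip; apply: contrapT => H; have [_ Kle] := hp.
move/(smallP _ hb): sA; apply.
apply: (@card_le_trans _ _ _ (E @` A)); last exact: card_image_le.
apply: Kle; split.
- move=> _ [j Aj <-]; apply: sub_infinite_set (fip [:: j] _); last by move=> ? [<-|].
  by move=> n /=; apply; left.
- move=> G GE /finite_seqP[gs Ggs].
  have [s sA Hs] : exists2 s, (forall j, List.In j s -> A j) &
      forall g, g \in gs -> exists2 j, List.In j s & E j = g.
    have {Ggs} : forall g, g \in gs -> (E @` A) g.
      by move=> g ggs; apply: GE; rewrite Ggs.
    elim: gs => [|g gs IH] Hgs; first by exists [::].
    have [|s sA Hs] := IH; first by move=> h hg; apply: Hgs; rewrite inE hg orbT.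
    have [j Aj jg] := Hgs g (mem_head _ _).
    exists (j :: s) => [i [<-//|/sA]//|h].
    rewrite inE => /orP[/eqP ->|/Hs[i si ih]]; first by exists j => //; left.
    by exists i => //; right.
  apply: sub_infinite_set (fip s sA) => n Hn g; rewrite Ggs => /Hs[j js <-].
  exact: Hn.
- move=> [P Pinf HP]; apply: H; exists P => // j Aj; apply: HP.
  by exists j.
Qed.

(** An element [n] of [x] exceeds all values of [h] at arguments up to any
    smaller element of [x]. *)
Definition sparse (h : nat -> nat) (x : set nat) :=
  forall m n, x m -> x n -> (m < n)%N -> forall k, (k <= m)%N -> (h k < n)%N.

Lemma sparse_subset (h : nat -> nat) (x : set nat) : infinite_set x ->
  exists y, [/\ infinite_set y, y `<=` x & sparse h y].
Proof.
move=> /infinite_natP xinf.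
have /choice[nx Hnx] : forall k, exists n, (k <= n)%N /\ x n.
  by move=> k; have [n kn xn] := xinf k; exists n.
pose step m := nx (m + \max_(k < m.+1) h k).+1.
pose u n := iter n step (nx 0).
have uS n : (u n < u n.+1)%N /\ forall k, (k <= u n)%N -> (h k < u n.+1)%N.
  rewrite /u iterS -/(u n) {2}/step; set m := u n.
  have [H _] := Hnx (m + \max_(k < m.+1) h k).+1; split.
    by rewrite /step; move: H; set q := \max_(_ < _) _; lia.
  move=> k km; have := @leq_bigmax _ (fun i : 'I_m.+1 => h i) (@Ordinal m.+1 k km).
  by rewrite /step; move: H => /=; set q := \max_(_ < _) _; lia.
have umon i j : (i <= j)%N -> (u i <= u j)%N.
  by apply: (homo_leq (leqnn) leq_trans) => n; have [] := uS n; lia.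
exists (range u); split.
- apply/infinite_natP => k; exists (u k); last by exists k.
  by elim: k => // k IH; have [] := uS k; lia.
- move=> _ [[|n] _ <-]; first by have [] := Hnx 0.
  by rewrite /u iterS /step; have [] := Hnx (iter n step (nx 0) +
    \max_(k < (iter n step (nx 0)).+1) h k).+1.
- move=> _ _ [i _ <-] [j _ <-] uij k ki.
  have ij : (i < j)%N by rewrite ltnNge; apply/negP => /umon; lia.
  by have [_ /(_ k ki)] := uS i; have := umon _ _ ij; lia.
Qed.

Lemma tower_exists : exists x : I -> set nat,
  [/\ forall a, infinite_set (x a),
      forall a b, lt b a -> almost_subset (x a) (x b) &
      forall a, sparse (f a) (x a)].
Proof.
have [||x Hx] := @wf_rec_choice I (set nat) lt setT
  (fun a x v => [/\ infinite_set v, forall b, lt b a -> almost_subset v (x b) &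
     sparse (f a) v]) (so_wf _ _ so).
- by move=> a x x' v xx' [vi va vs]; split=> // b ba; rewrite -xx' //; apply: va.
- move=> a x Hx.
  (* finitely many members of a tower have one that is almost contained in the
     others; [setT] stands for the intersection of the empty family *)
  have chain s : (forall b, List.In b s -> lt b a) ->
    exists v, [/\ v = setT \/ exists2 b, lt b a & v = x b &
      exists k, forall n, (k <= n)%N -> v n -> forall b, List.In b s -> x b n].
    elim: s => [|c s IH] Hs; first by exists setT; split; [left|exists 0].
    have [|v [vx [k Hk]]] := IH; first by move=> b bs; apply: Hs; right.
    have ca : lt c a by apply: Hs; left.
    case: vx => [vT|[b ba vb]].
      exists (x c); split; first by right; exists c.
      by exists k => n kn xn b [<-//|]; apply: Hk => //; rewrite vT.
    have [bc|bc|cb] := so_total _ _ so b c.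
    - exists (x c); split; first by right; exists c.
      have [_ /(_ b bc)/almost_subsetP[l Hl] _] := Hx c ca.
      exists (k + l) => n kn xn d [<-//|]; apply: Hk; first by lia.
      by rewrite vb; apply: Hl => //; lia.
    - exists (x c); split; first by right; exists c.
      exists k => n kn xn d [<-//|]; apply: Hk; first by lia.
      by rewrite vb bc.
    - exists (x b); split; first by right; exists b.
      have [_ /(_ c cb)/almost_subsetP[l Hl] _] := Hx b ba.
      exists (k + l) => n kn xn d [<-|]; first by apply: Hl => //; lia.
      by apply: Hk; [lia|rewrite vb].
  have fip s : (forall b, List.In b s -> lt b a) ->
      infinite_set [set n | forall b, List.In b s -> x b n].
    move=> Hs; have [v [vx [k Hk]]] := chain s Hs.
    have /infinite_natP vinf : infinite_set v.
      case: vx => [->|[b ba ->]]; first exact: infinite_nat.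
      by have [] := Hx b ba.
    apply/infinite_natP => m; have [n mn vn] := vinf (m + k).
    by exists n; [lia|move=> b bs; apply: (Hk n) => //; lia].
  have [P Pinf HP] := small_pseudointersection _ x (so_small _ _ so a) fip.
  have [Q [Qinf QP Qs]] := sparse_subset (f a) P Pinf.
  exists Q; split=> // b ba; have /almost_subsetP[k Hk] := HP b ba.
  by apply/almost_subsetP; exists k => n kn /QP; apply: Hk.
by exists x; split=> a; have [] := Hx a.
Qed.

(** If all gaps of all [x a] were eventually bounded by [g], two successive gaps
    above an argument [n] would bound [f a n] by two iterates of (a monotone
    majorant of) [g]. *)
Lemma tower_unbounded (x : I -> set nat) (g : nat -> nat) :
  (forall a, infinite_set (x a)) -> (forall a, sparse (f a) (x a)) ->
  exists a, forall k, exists n, [/\ (k <= n)%N, x a n &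
    forall m, x a m -> (n < m)%N -> (g n < m)%N].
Proof.
move=> xinf xs; apply: contrapT => H; apply: funb.
pose G n := \max_(i < n.+1) g i.
have gG i n : (i <= n)%N -> (g i <= G n)%N.
  move=> iN; exact: (@leq_bigmax _ (fun i : 'I_n.+1 => g i) (@Ordinal n.+1 i iN)).
exists (fun n => G (G n)) => _ [a _ <-]; apply/lt_mod_finiteP.
have [k Hk] : exists k, forall n, (k <= n)%N -> x a n ->
    exists m, [/\ x a m, (n < m)%N & (m <= g n)%N].
  apply: contrapT => Hk; apply: H; exists a => k; apply: contrapT => Hn.
  apply: Hk; exists k => n kn xn; apply: contrapT => Hm; apply: Hn.
  exists n; split=> // m xm nm; rewrite ltnNge; apply/negP => mg.
  by apply: Hm; exists m.
have /infinite_natP/(_ k)[e ke xe] := xinf a.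
exists e => n en.
have exP : exists b, `[< x a b >] && (e <= b <= n)%N.
  by exists e; apply/and3P; split=> //; apply/asboolP.
have ubP b : `[< x a b >] && (e <= b <= n)%N -> (b <= n)%N.
  by case/andP => _ /andP[].
(* [i] is the last element of [x a] up to [n] *)
have [i /andP[/asboolP xi /andP[ei iN]] imax] := ex_maxnP exP ubP.
have [m [xm im mg]] := Hk i (leq_trans ke ei) xi.
have nm : (n < m)%N.
  rewrite ltnNge; apply/negP => mn; suff : (m <= i)%N by lia.
  by apply: imax; apply/and3P; split=> //; [apply/asboolP|exact: leq_trans ei (ltnW im)].
have [|m' [xm' mm' mg']] := Hk m _ xm; first by lia.
have := xs a m m' xm xm' mm' n (ltnW nm).
have := gG i n iN; have : (m <= G n)%N by apply: leq_trans mg (gG i n iN).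
by move=> /gG; lia.
Qed.

End scale_theory.

(** * Topologies generated by two-valued functions *)

(** The set [X] with the coarsest topology for which all maps [chi j] into the
    discrete two-point space are continuous. *)
Definition char_space {J : Type} {X : choiceType} (chi : J -> X -> bool) : Type :=
  X.

(** The points that [chi j] does not distinguish from [t], for [j] in [s]. *)
Definition cylinder {J : Type} {X : choiceType} (chi : J -> X -> bool)
    (s : seq J) (t : X) : set X :=
  [set y | forall j, List.In j s -> chi j y = chi j t].

Section generated_topology.
Context {J : Type} {X : choiceType} (chi : J -> X -> bool).
Local Notation S := (char_space chi).
Local Notation cyl := (cylinder chi).

HB.instance Definition _ := Choice.on S.

Definition char_nbhs (t : S) : set_system S := [set V | exists s, cyl s t `<=` V].

HB.instance Definition _ := hasNbhs.Build S char_nbhs.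

Lemma cylinder_cat s s' t : cyl (s ++ s') t = cyl s t `&` cyl s' t.
Proof.
apply/seteqP; split=> y /= H.
  by split=> j js; apply: H; apply/List.in_or_app; [left|right].
by case: H => H1 H2 j /(@List.in_app_or _ s s')[]; [apply: H1|apply: H2].
Qed.

Lemma char_nbhs_filter (t : S) : ProperFilter (nbhs t).
Proof.
apply: Build_ProperFilter_ex.
  by move=> V [s sV]; exists t; apply: sV.
split.
- by exists [::].
- move=> V W [s sV] [s' sW]; exists (s ++ s'); rewrite cylinder_cat => y [ys ys'].
  by split; [apply: sV|apply: sW].
- by move=> V W VW [s sV]; exists s; apply: subset_trans VW.
Qed.

Lemma char_nbhs_singleton (t : S) (V : set S) : nbhs t V -> V t.
Proof. by move=> [s]; apply. Qed.

Lemma cylinder_eq s t u : cyl s t u -> cyl s u `<=` cyl s t.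
Proof. by move=> tu y uy j js; rewrite uy // tu. Qed.

Lemma char_nbhs_nbhs (t : S) (V : set S) : nbhs t V -> nbhs t (nbhs^~ V).
Proof.
move=> [s sV]; exists s => u tu; exists s.
exact: subset_trans (cylinder_eq _ _ _ tu) sV.
Qed.

HB.instance Definition _ := Nbhs_isNbhsTopological.Build S
  char_nbhs_filter char_nbhs_singleton char_nbhs_nbhs.

Lemma char_openP (V : set S) :
  open V <-> forall t, V t -> exists s, cyl s t `<=` V.
Proof. by rewrite openE. Qed.

Lemma cylinder_clopen s t : clopen (cyl s t : set S).
Proof.
split; first by apply/char_openP => u tu; exists s; apply: cylinder_eq.
rewrite -openC; apply/char_openP => u ntu; exists s => y uy ty; apply: ntu.
by move=> j js; rewrite -uy // ty.
Qed.

Lemma char_has_clopen_base : has_clopen_base S.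
Proof.
exists [set V | exists p : seq J * X, V = cyl p.1 p.2].
  by move=> _ [p ->]; apply: cylinder_clopen.
split; first by move=> _ [p ->]; have [] := cylinder_clopen p.1 p.2.
move=> t V [s sV]; exists (cyl s t) => //; split=> //.
by exists (s, t).
Qed.

Lemma char_closureP (A : set S) (t : S) :
  closure A t <-> forall s, exists2 y, A y & cyl s t y.
Proof.
split=> [At s|H V [s sV]].
  have [|y [Ay ty]] := At (cyl s t); first by exists s.
  by exists y.
by have [y Ay /sV Vy] := H s; exists y.
Qed.

Lemma char_cvgP (u : nat -> S) (t : S) : u @ \oo --> t <->
  forall j, exists N, forall n, (N <= n)%N -> chi j (u n) = chi j t.
Proof.
split=> [ut j|H V [s sV]].
  have [|N _ HN] := ut (cyl [:: j] t); first by exists [:: j].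
  by exists N => n /HN /(_ j); apply; left.
suff [N HN] : exists N, forall n, (N <= n)%N -> cyl s t (u n).
  by exists N => // n /HN /sV.
elim: s {sV} => [|j s [N HN]]; first by exists 0 => n _ j [].
have [M HM] := H j; exists (N + M) => n nNM i [<-|]; first by apply: HM; lia.
by apply: HN; lia.
Qed.

Lemma char_hausdorff :
  (forall t u, t <> u -> exists j, chi j t <> chi j u) -> hausdorff_space S.
Proof.
move=> sep t u tu; apply: contrapT => /sep[j]; apply.
have [||y [ty uy]] := tu (cyl [:: j] t) (cyl [:: j] u).
- by exists [:: j].
- by exists [:: j].
by rewrite -(ty j (or_introl erefl)) (uy j (or_introl erefl)).
Qed.

End generated_topology.

(** * Words and their values *)

(** A word is listed with its last entry at the head, so that extensions of a
    word [t] are the words with suffix [t]. *)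
Definition word : choiceType := seq (nat * nat).

(** The height of the last entry.  The entry is encoded as a pair [(n, d)], its
    height being [d + n + 1] plus the previous height; this makes it exceed its
    column [n] and the previous height whatever [d] is. *)
Fixpoint height (t : seq (nat * nat)) : nat :=
  if t is q :: t' then (height t' + q.1 + q.2).+1 else 0.

(** [x] has an element in the interval from [a] to [b], [b] excluded. *)
Definition touches (x : set nat) (a b : nat) : Prop :=
  exists2 m, x m & (a <= m < b)%N.

(** The last entry of [t] hits [x]: its column is in [x], and no element of [x]
    lies strictly between its column and its height. *)
Definition hit (x : set nat) (t : seq (nat * nat)) : Prop :=
  if t is q :: _ then x q.1 /\ ~ touches x q.1.+1 (height t) else False.

(** An entry of [t] other than the last one hits [x], and [x] has an element
    between its height and the next one. *)
Fixpoint recall (x : set nat) (t : seq (nat * nat)) : Prop :=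
  if t is q :: t' then
    touches x (height t') (height t) /\ hit x t' \/ recall x t'
  else False.

(** Whether some entry hits [x] and is not forgotten at [x]. *)
Definition value (x : set nat) (t : seq (nat * nat)) : bool :=
  `[< hit x t \/ recall x t >].

Lemma height_cons q t :
  [/\ (height t < height (q :: t))%N, (q.1 < height (q :: t))%N & (q.2 < height (q :: t))%N].
Proof. by rewrite /=; split; lia. Qed.

Lemma height_cat u t : (height t <= height (u ++ t))%N.
Proof. by elim: u => //= q u IH; lia. Qed.

Lemma value_nil x : value x [::] = false.
Proof. by apply/asboolPn => -[]. Qed.

Lemma value_hit x n d t (k : nat) : x n -> (forall m, x m -> (n < m)%N -> (k < m)%N) ->
  (height ((n, d) :: t) <= k)%N -> value x ((n, d) :: t) = true.
Proof.
move=> xn gap tk; apply/asboolP; left; split=> // -[m xm /andP[nm mt]].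
by have := gap m xm nm; lia.
Qed.

(** New entries within a gap of [x] are forgotten, except the last one. *)
Lemma value_cat x u q t : touches x (height t) (height (q :: t)) ->
  ~ touches x (height (q :: t)) (height (u ++ q :: t)) -> ~ hit x (u ++ q :: t) ->
  value x (u ++ q :: t) = value x t.
Proof.
move=> mt nm nh.
suff E : recall x (u ++ q :: t) <-> hit x t \/ recall x t.
  apply: asbool_equiv_eq; split=> [[/nh|/E]|/E] //.
  by right.
elim: u nm {nh} => [_|p u IH nm].
  split=> /= -[]; [by case; left|by right| |by right].
  by move=> ht; left; split.
have nm' : ~ touches x (height (q :: t)) (height (u ++ q :: t)).
  move=> [m xm /andP[m1 m2]]; apply: nm; exists m => //.
  by rewrite m1; apply: (ltn_trans m2); have [] := height_cons p (u ++ q :: t).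
split=> [[[[m xm /andP[m1 m2]] _]|/(IH nm')]|/(IH nm')]; [|by []|by right].
exfalso; apply: nm; exists m => //; apply/andP; split=> //.
exact: leq_trans (height_cat u (q :: t)) m1.
Qed.

Lemma value_cons x n t : infinite_set x ->
  exists k, forall d, (k <= d)%N -> value x ((n, d) :: t) = value x t.
Proof.
move=> /infinite_natP xinf.
have [m nm xm] := xinf n.+1; have [m' tm' xm'] := xinf (height t).
exists (m + m') => d dm; apply: (@value_cat x [::] (n, d) t).
- by exists m' => //=; lia.
- by move=> [l _ /andP[/leq_ltn_trans h /h]]; rewrite ltnn.
- by move=> /= -[_]; apply; exists m => //=; lia.
Qed.

Lemma suffix_total (T : eqType) (s1 s2 s : seq T) :
  suffix s1 s -> suffix s2 s -> (size s1 <= size s2)%N -> suffix s1 s2.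
Proof.
rewrite !suffixE => /eqP E1 /eqP E2 s12.
have s2s : (size s2 <= size s)%N by rewrite -E2 size_drop; lia.
rewrite -{2}E2 drop_drop -[X in _ == X]E1; apply/eqP; congr drop; lia.
Qed.

Section space.
Context {I : Type} (x : I -> set nat).

(** The coordinates of a word: membership in the set of extensions of [u], and
    the value at [x a]. *)
Definition char (j : word + I) (t : word) : bool :=
  match j with
  | inl u => suffix u t
  | inr a => value (x a) t
  end.

Lemma char_separated (t u : word) : t <> u -> exists w : word,
  char (inl w) t <> char (inl w) u.
Proof.
move=> tu; have [ut|nut] := boolP (suffix t u); last first.
  by exists t; rewrite /= suffix_refl (negbTE nut).
exists u => /=; rewrite suffix_refl => tu'.
apply: tu; move: ut tu' => /suffixP[v ->] /suffixP[w].
move=> /(congr1 size); rewrite !size_cat; case: v => //= p v; lia.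
Qed.

Hypothesis xinf : forall a, infinite_set (x a).

(** Every column contains words as close to [t] as desired. *)
Lemma char_cons n (t : word) (s : seq (word + I)) :
  exists d, cylinder char s t ((n, d) :: t).
Proof.
suff [k Hk] : exists k, forall d, (k <= d)%N -> cylinder char s t ((n, d) :: t).
  by exists k; apply: Hk.
elim: s => [|j s [k Hk]]; first by exists 0 => d _ j [].
suff [l Hl] : exists l, forall d, (l <= d)%N -> char j ((n, d) :: t) = char j t.
  exists (k + l) => d kd i [<-|]; first by apply: Hl; lia.
  by apply: Hk; lia.
case: j => [u|a] /=; last exact: value_cons.
exists (height u) => d ud; apply/idP/idP => ut; last first.
  exact: suffix_trans ut (suffix_cons _ _).
case: (leqP (size u) (size t)) => su.
  by apply: suffix_total ut _ su; apply: suffix_cons.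
exfalso; have /suffixP[v E] : suffix ((n, d) :: t : word) u.
  by apply: suffix_total (suffix_refl _) ut _.
by have := height_cat v ((n, d) :: t); rewrite -E /=; lia.
Qed.

End space.

(** * Convergent sequences *)

Section frechet.
Context {U : Type} (kappa : set U).
Hypothesis hb : is_bounding_number kappa.
Hypothesis hp : is_pseudointersection_number kappa.
Context {I : Type} {lt : I -> I -> Prop} {f : I -> nat -> nat}.
Hypothesis so : scale_order I lt.
Hypothesis funb : unbounded_family (range f).
Context {x : I -> set nat}.
Hypothesis xinf : forall a, infinite_set (x a).
Hypothesis xdec : forall a b, lt b a -> almost_subset (x a) (x b).
Hypothesis xsparse : forall a, sparse (f a) (x a).

Local Notation chi := (char x).

(** The coordinates given by words, and by the members of the tower below [a]. *)
Definition below (a : I) : set (word + I) :=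
  [set j | if j is inr b then lt b a else True].

(** Convergence of the coordinates in [D]. *)
Definition converges (D : set (word + I)) (c : nat -> word) (t : word) : Prop :=
  forall j, D j -> exists N, forall n, (N <= n)%N -> chi j (c n) = chi j t.

Lemma converges_cylinder D c t s : converges D c t ->
  (forall j, List.In j s -> D j) ->
  exists N, forall n, (N <= n)%N -> cylinder chi s t (c n).
Proof.
move=> ct; elim: s => [|j s IH] Ds; first by exists 0 => n _ j [].
have [|N HN] := IH; first by move=> i si; apply: Ds; right.
have [|M HM] := ct j; first by apply: Ds; left.
exists (N + M) => n nNM i [<-|]; first by apply: HM; lia.
by apply: HN; lia.
Qed.

Lemma small_below a : small (below a).
Proof.
apply: (@small_sub _ _ (range inl `|` inr @` [set b | lt b a])).
  by move=> [u|b] H; [left; exists u|right; exists b].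
apply: small_setU; apply: small_image; first exact: small_countType.
exact: (so_small _ _ so).
Qed.

Lemma below_exists (s : seq (word + I)) :
  exists b, forall j, List.In j s -> below b j.
Proof.
have [b Hb] := seq_bounded so funb
  (flatten [seq if j is inr a then [:: a] else [::] | j <- s]).
exists b => -[//|a] js; apply: Hb; elim: s js => //= j r IH [->|/IH H].
  by left.
by apply/List.in_or_app; right.
Qed.

Lemma converges_below_exists (A : set word) (t : word) (a : I) :
  ~ A t -> (forall s, exists2 y, A y & cylinder chi s t y) ->
  exists2 c : nat -> word, forall n, A (c n) & converges (below a) c t.
Proof.
move=> nAt At.
have /choice[sep Hsep] : forall y, exists w : word,
    y <> t -> chi (inl w) y <> chi (inl w) t.
  move=> y; have [->|yt] := pselect (y = t); first by exists [::].
  by have [w Hw] := char_separated x _ _ yt; exists w.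
pose E j := [set n | exists y : word,
  [/\ pickle y = n, A y & chi j y = chi j t]].
have fip s : (forall j, List.In j s -> below a j) ->
    infinite_set [set n | forall j, List.In j s -> E j n].
  move=> _; apply/infinite_natP => k.
  (* coordinates separating [t] from all words of code below [k] *)
  have [low Hlow] : exists low : seq (word + I),
      forall y, (pickle y < k)%N -> List.In (inl (sep y)) low.
    elim: k => [|k [low Hlow]]; first by exists [::].
    exists (if unpickle k is Some y then inl (sep y) :: low else low) => y.
    rewrite ltnS leq_eqVlt => /orP[/eqP <-|/Hlow]; first by rewrite pickleK; left.
    by case: unpickle => // z; right.
  have [y Ay ty] := At (s ++ low); move: ty; rewrite cylinder_cat => -[ys ylow].
  have yt : y <> t by move=> yt; apply: nAt; rewrite -yt.
  exists (pickle y); last first.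
    by move=> j js; exists y; split=> //; apply: ys.
  rewrite leqNgt; apply/negP => yk; apply: (Hsep y yt); apply: ylow.
  exact: Hlow.
have [P /infinite_natP Pinf HP] :=
  small_pseudointersection kappa hb hp _ E (small_below a) fip.
have /almost_subsetP[k0 Hk0] := HP (inl [::]) Logic.I.
have /choice[c Hc] : forall n, exists y : word,
    [/\ A y, P (pickle y) & (n <= pickle y)%N].
  move=> n; have [m nm Pm] := Pinf (n + k0).
  have [|y [my Ay _]] := Hk0 m _ Pm; first by lia.
  by exists y; rewrite my; split=> //; lia.
exists c => [n|j Dj]; first by have [] := Hc n.
have /almost_subsetP[N HN] := HP j Dj.
exists N => n Nn; have [_ Pn nn] := Hc n.
have [y [yc _ <-]] := HN _ (leq_trans Nn nn) Pn.
by rewrite (pcan_inj pickleK yc).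
Qed.

(** A sequence converging in all coordinates below [a] may be chosen such that
    some later member of the tower has no element from [lo (c n)] to
    [height (c n)], for all [n].  The hypothesis on [lo] says that it tends to
    infinity along the sequences that converge below [a0]. *)
Lemma converges_gap_exists (A : set word) (t : word) (lo : word -> nat)
    (a0 a : I) :
  ~ A t -> (forall s, exists2 y, A y & cylinder chi s t y) ->
  (forall M, exists2 s, forall j, List.In j s -> below a0 j &
     forall c, A c -> cylinder chi s t c -> (M <= lo c)%N) ->
  exists b (c : nat -> word), [/\ lt a b, forall n, A (c n),
    converges (below a) c t, forall n, (n <= lo (c n))%N &
    forall n, ~ touches (x b) (lo (c n)) (height (c n))].
Proof.
move=> nAt At Hlo.
have [a' Ha'] := seq_bounded so funb [:: a0; a].
have a0a' : lt a0 a' by apply: Ha'; left.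
have aa' : lt a a' by apply: Ha'; right; left.
have sub d : lt d a' -> below d `<=` below a'.
  by move=> da [//|b] /= bd; apply: (so_trans _ _ so) bd da.
have [c cA ct] := converges_below_exists A t a' nAt At.
have /choice[i Hi] : forall n, exists i, (n <= i)%N /\ (n < lo (c i))%N.
  move=> n; have [s sD Hs] := Hlo n.+1.
  have [N HN] := converges_cylinder _ _ _ s ct (fun j js => sub _ a0a' _ (sD j js)).
  exists (n + N); split; first by lia.
  by apply: Hs => //; apply: HN; lia.
(* a gap of [x b0] from [n] to that height contains the whole interval from
   [lo (c (i n))] to [height (c (i n))] *)
have [b0 Hb0] := tower_unbounded funb x (fun n => height (c (i n))) xinf xsparse.
have [b Hb] := seq_bounded so funb [:: b0; a].
have b0b : lt b0 b by apply: Hb; left.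
have /almost_subsetP[k Hk] := xdec _ _ b0b.
have /choice[m Hm] : forall n, exists m, [/\ (n + k <= m)%N, x b0 m &
    forall l, x b0 l -> (m < l)%N -> (height (c (i m)) < l)%N].
  by move=> n; apply: Hb0.
exists b, (fun n => c (i (m n))); split.
- by apply: Hb; right; left.
- by move=> n; apply: cA.
- move=> j Dj; have [N HN] := ct j (sub _ aa' _ Dj); exists N => n Nn.
  by apply: HN; have [] := Hi (m n); have [] := Hm n; lia.
- by move=> n; have [] := Hi (m n); have [] := Hm n; lia.
- move=> n [l xl /andP[l1 l2]]; have [_ mlo] := Hi (m n).
  have [nkm _ /(_ l)] := Hm n; have xb0 : x b0 l by apply: Hk => //; lia.
  by move=> /(_ xb0); lia.
Qed.

(** Iterating [converges_gap_exists] gives sequences [C (alpha m)] with indices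
    [alpha m] of supremum [al].  A diagonal sequence converges in the coordinates
    below [al], because fewer than [kappa] rates of convergence are dominated by
    one function; it converges in the others because [x b], for [b = al] and
    later, misses almost all the intervals from [lo (c m)] to [height (c m)]. *)
Lemma converges_exists (A : set word) (t : word) (lo : word -> nat) (a0 : I) :
  ~ A t -> (forall s, exists2 y, A y & cylinder chi s t y) ->
  (forall M, exists2 s, forall j, List.In j s -> below a0 j &
     forall c, A c -> cylinder chi s t c -> (M <= lo c)%N) ->
  (forall y, infinite_set y -> exists M, forall c, A c -> (M <= lo c)%N ->
     ~ touches y (lo c) (height c) -> value y c = value y t) ->
  (forall u : word, exists M, forall c, A c -> (M <= lo c)%N ->
     suffix u c = suffix u t) ->
  exists2 c : nat -> word, forall n, A (c n) & converges setT c t.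
Proof.
move=> nAt At Hlo Hval Hsuf.
have /choice[B /choice[C HBC]] := fun a =>
  converges_gap_exists A t lo a0 a nAt At Hlo.
pose alpha n := iter n B a0.
have alphaS n : lt (alpha n) (alpha n.+1) by have [] := HBC (alpha n).
have alpha_mon m n : (m < n)%N -> lt (alpha m) (alpha n).
  elim: n => // n IH; rewrite ltnS leq_eqVlt => /orP[/eqP ->//|/IH mn].
  exact: (so_trans _ _ so) mn (alphaS n).
have [al Hal al_lub] := omega_lub so funb alpha.
have lub b : lt b al -> exists n, forall m, (n <= m)%N -> lt b (alpha m).
  move=> /al_lub[n bn]; exists n.+1 => m nm.
  have nm' := alpha_mon _ _ nm.
  by case: bn => [->//|bn]; apply: (so_trans _ _ so) bn nm'.
have /choice[phi Hphi] : forall b, exists phi : nat -> nat,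
    forall m, lt b (alpha m) -> forall n, (phi m <= n)%N ->
      value (x b) (C (alpha m) n) = value (x b) t.
  move=> b; have /choice[phi Hphi] : forall m, exists N,
      lt b (alpha m) -> forall n, (N <= n)%N ->
        value (x b) (C (alpha m) n) = value (x b) t.
    move=> m; have [bm|] := pselect (lt b (alpha m)); last by exists 0.
    have [_ _ /(_ (inr b) bm)[N HN] _ _] := HBC (alpha m).
    by exists N.
  by exists phi.
have [g Hg] := so_small _ _ so al phi.
have /choice[k Hk] : forall m, exists k, forall n, (k <= n)%N -> x al n ->
    x (alpha m.+1) n.
  by move=> m; apply/almost_subsetP/xdec.
pose c m := C (alpha m) (g m + k m + m).
have cA m : A (c m) by have [_ + _ _ _] := HBC (alpha m); apply.
have clo m : (g m + k m + m <= lo (c m))%N.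
  by have [_ _ _ + _] := HBC (alpha m); apply.
have cgap m : ~ touches (x al) (lo (c m)) (height (c m)).
  move=> [l xl /andP[l1 l2]]; have [_ _ _ _] := HBC (alpha m).
  move=> /(_ (g m + k m + m)); apply; exists l; last by rewrite l1.
  by apply: Hk => //; have := clo m; lia.
have cgap_al b : b = al \/ lt al b -> exists N, forall m, (N <= m)%N ->
    ~ touches (x b) (lo (c m)) (height (c m)).
  case=> [->|alb]; first by exists 0.
  have /almost_subsetP[N HN] := xdec _ _ alb; exists N => m Nm.
  move=> [l xl /andP[l1 l2]]; apply: (cgap m); exists l; last by rewrite l1.
  by apply: HN => //; have := clo m; lia.
exists c => // -[u|b] _ /=.
  have [M HM] := Hsuf u; exists M => n Mn; apply: HM => //.
  by have := clo n; lia.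
have [lt_b_al|ge] : lt b al \/ (b = al \/ lt al b).
  by have [] := so_total _ _ so b al; auto.
- have [N HN] := lub b lt_b_al; have /lt_mod_finiteP[N' HN'] := Hg b lt_b_al.
  exists (N + N') => n nN; apply: Hphi; first by apply: HN; lia.
  by have : (phi b n < g n)%N; [apply: HN'; lia|lia].
- have [N HN] := cgap_al b ge; have [M HM] := Hval _ (xinf b).
  exists (N + M) => n nNM; apply: HM => //; last by apply: HN; lia.
  by have := clo n; lia.
Qed.

End frechet.

(** * The space *)

Lemma mem_In {T : eqType} (a : T) (s : seq T) : a \in s -> List.In a s.
Proof.
elim: s => // b s IH; rewrite inE => /orP[/eqP ->|/IH]; first by left.
by right.
Qed.

(** For a proper extension [c] of [t], the height of the first new entry. *)
Definition branch_height (t c : seq (nat * nat)) : nat :=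
  height (drop (size c - (size t).+1) c).

Lemma branch_height_cat t q u : branch_height t (u ++ q :: t) = height (q :: t).
Proof.
by rewrite /branch_height size_cat /= addnK drop_size_cat.
Qed.

Lemma suffix_neq (t c : word) : suffix t c -> c <> t ->
  exists u q, c = u ++ q :: t.
Proof.
move=> /suffixP[w ->]; case/lastP: w => // u q _.
by exists u, q; rewrite cat_rcons.
Qed.

(** The column of the last entry; the value at the empty word plays no role. *)
Definition column (c : seq (nat * nat)) : nat := (head (0, 0) c).1.

Section character_space.
Context {U : Type} (kappa : set U).
Hypothesis hb : is_bounding_number kappa.
Hypothesis hp : is_pseudointersection_number kappa.
Context {I : Type} {lt : I -> I -> Prop} {f : I -> nat -> nat}.
Hypothesis so : scale_order I lt.
Hypothesis funb : unbounded_family (range f).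
Context {x : I -> set nat}.
Hypothesis xinf : forall a, infinite_set (x a).
Hypothesis xdec : forall a b, lt b a -> almost_subset (x a) (x b).
Hypothesis xsparse : forall a, sparse (f a) (x a).

Local Notation chi := (char x).
Local Notation S := (char_space chi).

(** The first new heights tend to infinity along sequences converging to [t]
    in the word coordinates. *)
Lemma branch_height_large (t : word) (M : nat) : exists2 s : seq (word + I),
  forall j, List.In j s -> exists u, j = inl u &
  forall c, suffix t c -> c <> t -> cylinder chi s t c ->
    (M <= branch_height t c)%N.
Proof.
have [s sl Hs] : exists2 s : seq (word + I),
    forall j, List.In j s -> exists u, j = inl u &
    forall n d, (n < M)%N -> (d < M)%N -> List.In (inl ((n, d) :: t)) s.
  exists [seq inl (p :: t) | p <- allpairs pair (iota 0 M) (iota 0 M)].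
    move=> j /List.in_map_iff[p [<- _]].
    by exists (p :: t).
  move=> n d nM dM; apply/List.in_map_iff; exists (n, d); split=> //.
  apply: mem_In.
  by apply: allpairs_f; rewrite mem_iota.
exists s => // c tc ct sc.
have [u [[n d] E]] := suffix_neq _ _ tc ct; rewrite E branch_height_cat.
rewrite leqNgt; apply/negP => hM.
have nM : (n < M)%N by have [_] := height_cons (n, d) t; move: hM => /=; lia.
have dM : (d < M)%N by move: hM => /=; lia.
have := sc _ (Hs n d nM dM); rewrite /= E suffix_suffix => /esym/size_suffix.
by rewrite /= ltnn.
Qed.

Lemma suffix_branch (u t c : word) : suffix t c -> c <> t ->
  (height u < branch_height t c)%N -> suffix u c = suffix u t.
Proof.
move=> tc ct; have [v [q E]] := suffix_neq _ _ tc ct.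
rewrite E branch_height_cat => uq.
apply/idP/idP => [uc|ut]; last first.
  by apply: suffix_trans ut _; rewrite -cat_rcons suffix_suffix.
have tc' : suffix t (v ++ q :: t) by rewrite -cat_rcons suffix_suffix.
have [ut|tu] := leqP (size u) (size t); first exact: suffix_total uc tc' ut.
exfalso; have /suffixP[w Ew] : suffix (q :: t) u.
  by apply: suffix_total uc _; rewrite ?suffix_suffix.
by move: uq; rewrite ltnNge Ew height_cat.
Qed.

Lemma value_branch (y : set nat) (t c : word) :
  suffix t c -> c <> t -> touches y (height t) (branch_height t c) ->
  ~ touches y (branch_height t c) (height c) -> ~ hit y c ->
  value y c = value y t.
Proof.
move=> tc ct; have [v [q E]] := suffix_neq _ _ tc ct.
rewrite E branch_height_cat; exact: value_cat.
Qed.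

Lemma hitP (y : set nat) (c : seq (nat * nat)) : hit y c ->
  [/\ y (column c), (column c < height c)%N &
      ~ touches y (column c).+1 (height c)].
Proof. by case: c => // q c [yq nt]; split=> //; have [] := height_cons q c. Qed.

Lemma converges_setT (c : nat -> S) (t : S) :
  converges (x:=x) setT c t -> c @ \oo --> t.
Proof. by move=> H; apply/char_cvgP => j; apply: H. Qed.

(** By [value_branch], extensions of [t] have the value of [t] at a member of the
    tower with a suitable gap, unless their last entry hits it.  This is avoided
    in one of two ways.  If [t] is in the closure of the words of [A] of one last
    column [nu], only these are used: they do not hit a set [y] that has an
    element above [nu] below the gap.  Otherwise the last columns tend to infinity
    along the sequences converging to [t], and the gap is extended downwards so as
    to contain the last column. *)
Lemma frechet_urysohn_char : frechet_urysohn S.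
Proof.
move=> A t [/char_closureP At nAt].
pose A1 := A `&` [set c : word | suffix t c].
have A1t : forall s, exists2 y, A1 y & cylinder chi s t y.
  move=> s; have [y Ay ty] := At (inl t :: s); exists y.
    by split=> //; have := ty (inl t) (or_introl erefl); rewrite /= suffix_refl.
  by move=> j js; apply: ty; right.
have ne c : A c -> c <> t by move=> Ac ct; apply: nAt; rewrite -ct.
have [nu_case|all_nu] := pselect (exists nu, forall s, exists2 y,
    A1 y /\ column y = nu & cylinder chi s t y).
- have [nu Hnu] := nu_case.
  have [a0 _] := seq_bounded so funb [::].
  pose A2 := [set c | A1 c /\ column c = nu].
  have [|||||c cA ct] := @converges_exists _ kappa hb hp I lt f so funb x xinf
      xdec xsparse A2 t (branch_height t) a0.
  + by move=> [[]].
  + exact: Hnu.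
  + move=> M; have [s sl Hs] := branch_height_large t M.
    exists s; first by move=> j /sl[u ->].
    by move=> c [[Ac tc] _]; apply: Hs => //; apply: ne.
  + move=> y /infinite_natP yinf.
    have [m tm ym] := yinf (height t); have [m' nm' ym'] := yinf nu.+1.
    exists (m + m').+1 => c [[Ac tc] cnu] Mc nt.
    apply: value_branch => //; first exact: ne.
      by exists m => //; lia.
    move=> /hitP[_ _]; rewrite cnu; apply; exists m' => //.
    rewrite nm' /=; apply: (@leq_trans (branch_height t c)); first by lia.
    have [v [q ->]] := suffix_neq _ _ tc (ne _ Ac).
    by rewrite branch_height_cat height_cat.
  + move=> u; exists (height u).+1 => c [[Ac tc] _] Mc.
    by apply: suffix_branch => //; apply: ne.
  by exists c; [move=> n; have [[]] := cA n|exact: converges_setT].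
- have /choice[s Hs] : forall nu, exists s, forall y, A1 y -> cylinder chi s t y ->
      column y <> nu.
    move=> nu; apply: contrapT => H; apply: all_nu; exists nu => s.
    apply: contrapT => Hs; apply: H; exists s => y Ay ty ynu; apply: Hs.
    by exists y.
  have /choice[b Hb] : forall nu, exists b, forall j, List.In j (s nu) ->
      below (lt:=lt) b j.
    by move=> nu; apply: (below_exists so funb).
  have [a0 Ha0] := omega_bounded so funb b.
  pose lo c := minn (branch_height t c) (column c).
  have [|||||c cA ct] := @converges_exists _ kappa hb hp I lt f so funb x xinf
      xdec xsparse A1 t lo a0.
  + by move=> [].
  + exact: A1t.
  + move=> M; have [s' sl Hs'] := branch_height_large t M.
    have [r rb Hr] : exists2 r : seq (word + I), forall j, List.In j r ->
        below (lt:=lt) a0 j &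
        forall c, A1 c -> cylinder chi r t c -> (M <= column c)%N.
      elim: M {s' sl Hs'} => [|M [r rb Hr]]; first by exists [::].
      exists (s M ++ r) => [j /(@List.in_app_or _ (s M) r)[|/rb//]|c Ac].
        move=> /Hb; case: j => // d /= db.
        exact: (so_trans _ _ so) db (Ha0 M).
      rewrite cylinder_cat => -[c1 c2]; rewrite ltn_neqAle Hr // andbT.
      by apply/eqP => cM; apply: (Hs M c).
    exists (s' ++ r) => [j /(@List.in_app_or _ s' r)[/sl[u ->]//|/rb//]|c Ac].
    rewrite cylinder_cat => -[c1 c2]; rewrite leq_min Hr // andbT.
    by case: Ac => Ac tc; apply: Hs' => //; apply: ne.
  + move=> y /infinite_natP yinf.
    have [m tm ym] := yinf (height t).
    exists m.+1 => c [Ac tc] Mc nt; move: Mc; rewrite leq_min => /andP[M1 M2].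
    apply: value_branch => //; first exact: ne.
    * by exists m => //; lia.
    * move=> [l yl /andP[l1 l2]]; apply: nt; exists l => //.
      by rewrite l2 andbT; apply: leq_trans l1; apply: geq_minl.
    * move=> /hitP[yc hc _]; apply: nt; exists (column c) => //.
      by rewrite hc andbT geq_minr.
  + move=> u; exists (height u).+1 => c [Ac tc]; rewrite leq_min => /andP[Mc _].
    by apply: suffix_branch => //; apply: ne.
  by exists c; [move=> n; have [] := cA n|exact: converges_setT].
Qed.

(** The words with last column [n]. *)
Definition column_set (n : nat) : set S :=
  [set t : seq (nat * nat) | exists d t', t = (n, d) :: t'].

Lemma column_set_dense n : dense (column_set n).
Proof.
move=> V [t Vt] /char_openP /(_ t Vt)[s sV].
have [d td] := char_cons x xinf n t s.
by exists ((n, d) :: t); split; [apply: sV|exists d, t].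
Qed.

(** Finite subsets of the dense sets [column_set n], here those of the words of
    code less than [g n], can be avoided for infinitely many [n] by a single
    nonempty open set. *)
Lemma column_set_avoid (g : nat -> nat) : exists V : set S, [/\ open V, V !=set0 &
  forall k, exists2 n, (k <= n)%N &
    forall t, column_set n t -> (pickle t < g n)%N -> ~ V t].
Proof.
pose h n := \max_(i < g n) (if unpickle i is Some t then height t else 0).
have [a Ha] := tower_unbounded funb x h xinf xsparse.
exists (cylinder chi [:: inr a] [::]); split.
- by have [] := cylinder_clopen chi [:: inr a] [::].
- by exists [::].
move=> k; have [n [kn xn gap]] := Ha k; exists n => // t [d [t' ->]] tg.
move=> /(_ (inr a) (or_introl erefl)) /=; rewrite value_nil.
rewrite (value_hit _ _ _ _ (h n)) //.
have := @leq_bigmax _ (fun i : 'I_(g n) => if unpickle i is Some t then height t else 0) (Ordinal tg).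
by rewrite pickleK.
Qed.

Lemma not_h_separable_char : ~ h_separable S.
Proof.
move=> hsep; have [F HF Fd] := hsep column_set column_set_dense.
have /choice[g Hg] : forall n, exists k, forall t, F n t -> (pickle t < k)%N.
  move=> n; have [Ffin _] := HF n.
  have [k Hk] := (finite_natP _).1 (finite_image pickle Ffin).
  by exists k => t Ft; apply: Hk; exists t.
have [V [Vo V0 HV]] := column_set_avoid g.
pose A := [set n | forall t, column_set n t -> (pickle t < g n)%N -> ~ V t].
have Ainf : infinite_set A.
  by apply/infinite_natP => k; have [n kn Hn] := HV k; exists n.
have [t [Vt [n An Ft]]] := Fd A Ainf V V0 Vo.
by apply: (An t) => //; [have [_] := HF n; apply|apply: Hg].
Qed.

(** If [B] were small, one function would bound the codes of points of
    [column_set n] in all its members. *)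
Lemma pi_base_ge (B : set (set S)) : pi_base B -> kappa #<= B.
Proof.
move=> [Bo Bpi]; apply/(not_small_kappa _ hb) => sB.
have /choice[phi Hphi] : forall V : set S, exists phi : nat -> nat, B V ->
    forall n, exists t, [/\ column_set n t, V t & pickle t = phi n].
  move=> V; have [BV|] := pselect (B V); last by exists id.
  have [Vo V0] := Bo V BV.
  have /choice[phi Hphi] : forall n, exists m, exists t,
      [/\ column_set n t, V t & pickle t = m].
    by move=> n; have [t [Vt Dt]] := column_set_dense n V V0 Vo; exists (pickle t), t.
  by exists phi.
have [g Hg] := sB phi.
have [V [Vo V0 HV]] := column_set_avoid g.
have [W BW WV] := Bpi V Vo V0.
have /lt_mod_finiteP[N HN] := Hg W BW.
have [n Nn Hn] := HV N.
have [t [Dt Wt tphi]] := Hphi W BW n.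
by apply: (Hn t Dt _ (WV _ Wt)); rewrite tphi; apply: HN.
Qed.

Lemma pi_base_le : exists2 B : set (set S), pi_base B & B #<= kappa.
Proof.
exists (range (fun p : word * seq (word + I) => cylinder chi p.2 p.1)).
  split=> [_ [p _ <-]|V Vo [t Vt]].
    split; first by have [] := cylinder_clopen chi p.2 p.1.
    by exists p.1.
  have /char_openP /(_ t Vt)[s sV] := Vo.
  by exists (cylinder chi s t) => //; exists (t, s).
apply: (@card_le_trans _ _ _ [set: word * seq (word + I)]).
  exact: card_image_le.
have /choice[r Hr] : forall p : word * seq (word + I), exists b,
    forall j, List.In j p.2 -> below (lt:=lt) b j.
  by move=> p; apply: (below_exists so funb).
(* [r p] bounds the coordinates in the cylinder of [p] *)
apply: (small_fibers_card_le kappa hb so r) => a.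
apply: (@small_sub _ _ (\bigcup_(t in setT) [set (t, s) | s in
  [set s | forall j, List.In j s -> below (lt:=lt) a j]])).
  move=> [t s] /= Hra; exists t => //; exists s => // -[//|c] js /=.
  have /= rc := Hr (t, s) _ js; case: Hra => [<-//|ra].
  exact: (so_trans _ _ so) rc ra.
apply: small_bigcup => [|t _]; first exact: small_countType.
by apply/small_image/small_seq/(small_below so).
Qed.

Lemma is_pi_weight_char : is_pi_weight S kappa.
Proof.
split; last exact: pi_base_ge.
have [B Bpi BK] := pi_base_le; exists B => //.
by apply/card_eqPle; split=> //; apply: pi_base_ge.
Qed.

End character_space.

Theorem theorem3 (U : Type) (kappa : set U)
    (hp : is_pseudointersection_number kappa)
    (hb : is_bounding_number kappa) :
  exists X : topologicalType,
    [/\ countable [set: X], hausdorff_space X, has_clopen_base X,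
        frechet_urysohn X & (~ h_separable X /\ is_pi_weight X kappa)].
Proof.
have [I [lt [f [so funb]]]] := scale_exists kappa hb.
have [x [xinf xdec xs]] := tower_exists (f:=f) kappa hb so hp.
exists (char_space (char x)); split.
- exact: (@countableP (seq (nat * nat)) setT).
- apply: char_hausdorff => t u /(char_separated x)[w Hw].
  by exists (inl w).
- exact: char_has_clopen_base.
- exact: (frechet_urysohn_char kappa hb hp so funb xinf xdec xs).
- split; first exact: (not_h_separable_char funb xinf xs).
  exact: (is_pi_weight_char kappa hb so funb xinf xs).
Qed.
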